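(* Suppose $\mathcal{G}$ has $r$ connected components $\mathcal{G}_1,\dots,\mathcal{G}_r$. Let $\mu_1(\epsilon),\dots,\mu_r(\epsilon)$ be the eigenvalues of $M(\epsilon)$ whose zeroth-order term vanishes, i.e. $\mu_i(\epsilon)=\mu_i^{(0)}+\epsilon\mu_i^{(1)}+O(\epsilon^2)$ as $\epsilon\to 0^+$ with $\mu_1^{(0)}=\dots=\mu_r^{(0)}=0$. Then, up to ordering, the first-order coefficients are $\mu_1^{(1)}=\theta_1,\dots,\mu_r^{(1)}=\theta_r$, where $\theta_1,\dots,\theta_r$ are the eigenvalues (with multiplicity) of the symmetric $r\times r$ matrix $P$ with entries $$P_{ii}=\frac{2\,\#\mathcal{E}_\mathcal{H}^{(\mathcal{G}_i)}}{\#\mathcal{V}_{\mathcal{G}_i}},\qquad P_{ij}=\frac{\#\mathcal{E}_\mathcal{H}^{(\mathcal{G}_i,\mathcal{G}_j)}}{\sqrt{\#\mathcal{V}_{\mathcal{G}_i}\,\#\mathcal{V}_{\mathcal{G}_j}}}\quad (i\neq j).$$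
   Context: Let $\mathcal{F}=\{\mathcal{V},\mathcal{E}\}$ be a simple undirected graph with $\mathcal{V}=\{1,\dots,n\}$. Let $\mathcal{G}=\{\mathcal{V},\mathcal{E}_\mathcal{G}\}$ and $\mathcal{H}=\{\mathcal{V},\mathcal{E}_\mathcal{H}\}$ be subgraphs of $\mathcal{F}$ on the same vertex set with $\mathcal{E}_\mathcal{G}\cap\mathcal{E}_\mathcal{H}=\emptyset$ and $\mathcal{E}_\mathcal{G}\cup\mathcal{E}_\mathcal{H}=\mathcal{E}$. For a real parameter $\epsilon>0$ define the symmetric $n\times n$ matrix $M(\epsilon)=L_\mathcal{G}+\epsilon A_\mathcal{H}$, where $L_\mathcal{G}$ is the Laplacian matrix of $\mathcal{G}$ (degree matrix minus adjacency matrix) and $A_\mathcal{H}$ is the $0/1$ adjacency matrix of $\mathcal{H}$. The eigenvalues of $M(\epsilon)$ are expanded in powers of $\epsilon$ as $\mu_i(\epsilon)=\mu_i^{(0)}+\epsilon\mu_i^{(1)}+\epsilon^2\mu_i^{(2)}+\cdots$; the $\mu_i^{(0)}$ are the eigenvalues of $L_\mathcal{G}$. Exactly $r$ of them (with multiplicity) are zero when $\mathcal{G}$ has $r$ connected components. Notation: $\#\mathcal{V}_{\mathcal{G}_i}$ is the number of vertices of $\mathcal{G}_i$; $\#\mathcal{E}_\mathcal{H}^{(\mathcal{G}_i)}$ is the number of edges of $\mathcal{H}$ joining two vertices of $\mathcal{G}_i$; for $i\ne j$, $\#\mathcal{E}_\mathcal{H}^{(\mathcal{G}_i,\mathcal{G}_j)}$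 is the number of edges of $\mathcal{H}$ joining a vertex of $\mathcal{G}_i$ to a vertex of $\mathcal{G}_j$. *)

(* Defs.v *)
From HB Require Import structures.
From mathcomp Require Import all_boot all_order all_algebra.
From mathcomp Require Import all_classical all_reals all_analysis.
Import Order.TTheory GRing.Theory Num.Theory.
Import numFieldNormedType.Exports.

Set Implicit Arguments.
Unset Strict Implicit.
Unset Printing Implicit Defensive.

Local Open Scope ring_scope.

(* Simple undirected graphs on {1, ..., n} are adjacency relations on 'I_n. *)
Definition simple_graph (n : nat) (e : rel 'I_n) : Prop :=
  symmetric e /\ irreflexive e.

Definition components (n : nat) (e : rel 'I_n) : {set {set 'I_n}} :=
  equivalence_partition (connect e) [set: 'I_n].

(* An edge is the unordered pair [set x; y], so every edge counts once, also
   when A = B; then these are the edges with both endpoints in A. *)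
Definition edges_between (n : nat) (e : rel 'I_n) (A B : {set 'I_n}) :
    {set {set 'I_n}} :=
  [set [set x; y] | x in A, y in B & e x y].

Definition adjacency (R : realType) (n : nat) (e : rel 'I_n) : 'M[R]_n :=
  \matrix_(i, j) (e i j)%:R.

Definition degree_mx (R : realType) (n : nat) (e : rel 'I_n) : 'M[R]_n :=
  diag_mx (\row_i #|[set j | e i j]|%:R).

Definition laplacian (R : realType) (n : nat) (e : rel 'I_n) : 'M[R]_n :=
  degree_mx R e - adjacency R e.

Definition perturbed_laplacian (R : realType) (n : nat) (G H : rel 'I_n)
    (eps : R) : 'M[R]_n :=
  laplacian R G + eps *: adjacency R H.

(* [s] lists all the eigenvalues of [A], repeated according to their
   multiplicities as roots of the characteristic polynomial. *)
Definition eigenvalue_list (R : realType) (n : nat) (A : 'M[R]_n)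
    (s : seq R) : Prop :=
  char_poly A = \prod_(a <- s) ('X - a%:P).

Definition component_mx (R : realType) (n r : nat) (H : rel 'I_n)
    (C : 'I_r -> {set 'I_n}) : 'M[R]_r :=
  \matrix_(i, j)
    if i == j then
      2 * #|edges_between H (C i) (C i)|%:R / #|C i|%:R
    else
      #|edges_between H (C i) (C j)|%:R / Num.sqrt (#|C i|%:R * #|C j|%:R).

(* Main.v *)
(** Substitute [x = e t] in the characteristic polynomial of [L + e A]. Let the
rows of [B] be the normalised indicators of the components, so that
[B B^T = 1], [L B^T = 0] and [B A B^T] is the component matrix. Bordering the
matrix by [B] turns [det (e t - L - e A)] into [e ^ r] times a determinant that
tends, as [e] tends to [0+], to a nonzero multiple of
[char_poly (B A B^T)] at [t]; the multiple is [det (L + B^T B)] up to sign, and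
[L + B^T B] is invertible because the kernel of [L] is spanned by the rows of
[B]. The expansions of the eigenvalues make the same determinant [e ^ m] times
a quantity tending to a nonzero multiple of the product of the [t - mu1 i],
where [m] is the number of [i] with [mu0 i = 0]. Hence [m = r] and the two monic
polynomials in [t] agree. *)

Require Import Defs.
From HB Require Import structures.
From mathcomp Require Import all_boot all_order all_algebra.
From mathcomp Require Import all_classical all_reals all_analysis.
From mathcomp Require Import ring.
Import Order.TTheory GRing.Theory Num.Theory.
Import numFieldNormedType.Exports.

Local Open Scope ring_scope.

(** * Polynomial identities and bordered determinants *)

Lemma poly_ext (R : numDomainType) (p q : {poly R}) :
  (forall t, p.[t] = q.[t]) -> p = q.
Proof.
move=> pq; apply/eqP; rewrite -subr_eq0; apply/negPn/negP => nz.
(* In characteristic zero the values [k%:R] are pairwise distinct, so a nonzero difference would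
   have as many roots as its size, one more than its degree allows. *)
have := max_poly_roots nz (rs := [seq k%:R | k <- iota 0 (size (p - q))]).
rewrite size_map size_iota ltnn map_inj_uniq ?iota_uniq; last exact/mulrIn/oner_neq0.
move=> /(_ _ isT) H; suff /H : all (root (p - q)) [seq k%:R | k <- iota 0 (size (p - q)%R)] by [].
by apply/allP => x _; rewrite rootE !hornerE pq subrr.
Qed.

Lemma horner_char_poly (R : comNzRingType) n (A : 'M[R]_n) (t : R) :
  (char_poly A).[t] = \det (t%:M - A).
Proof.
rewrite -[LHS]/(horner_eval t (char_poly A)) -det_map_mx; congr (\det _).
apply/matrixP => i j; rewrite !mxE.
by rewrite /= /horner_eval hornerD hornerN hornerC hornerMn hornerX.
Qed.

Lemma det_bordered_scale (R : comNzRingType) n r (L A : 'M[R]_n)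
    (B : 'M[R]_(r, n)) (e t : R) :
  L *m B^T = 0 -> B *m B^T = 1%:M ->
  \det ((e * t)%:M - (L + e *: A)) =
  e ^+ r * \det (block_mx ((e * t)%:M - (L + e *: A) - B^T *m B)
                          ((A - t%:M) *m B^T) B 0).
Proof.
move=> LB BB; set M := _ - (L + _).
(* Two shears by [B^T] clear the corner [1] of [[M, 0], [B, 1]] (as
   [B B^T = 1]) and leave a right block divisible by [e] (as [L B^T = 0]). *)
have -> : \det M = \det (block_mx M 0 B 1%:M) by rewrite det_lblock det1 mulr1.
have shear : \det (block_mx 1%:M (- B^T) 0 1%:M) = 1
  by rewrite det_ublock !det1 mulr1.
rewrite -[LHS]mulr1 -[LHS]mul1r -[X in X * (_ * _)]shear -[X in _ * (_ * X)]shear.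
have -> : e ^+ r = \det (block_mx (1%:M : 'M[R]_n) 0 0 (e%:M : 'M[R]_r)).
  by rewrite det_ublock det1 det_scalar mul1r.
rewrite [RHS]mulrC -!det_mulmx !mulmx_block; congr (\det (block_mx _ _ _ _)).
- by rewrite !(mul1mx, mulmx1, mulmx0, addr0) mulNmx.
- rewrite !(mul1mx, mulmx1, mulmx0, add0r, addr0, mulNmx, mulmxN).
  rewrite BB addNr mulmx0 subr0 mul_mx_scalar.
  rewrite /M mulmxBl mulmxDl LB add0r opprB -scalemxAl mulmxBl.
  by rewrite !mul_scalar_mx scalerBr scalerA.
- by rewrite !(mul1mx, mul0mx, mulmx1, mulmx0, add0r, addr0).
- by rewrite !(mul0mx, mul1mx, mulmx1, mulmx0, add0r, addr0, mulmxN) BB addrC subrr.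
Qed.

(** Adding [B] times the first block row to the second makes the matrix block triangular: the lower
    left corner becomes [- B + B = 0], and the diagonal blocks are [- (L + B^T *m B)] and
    [- (t%:M - B *m A *m B^T)], whence the sign. *)
Lemma det_bordered0 (R : comNzRingType) n r (L A : 'M[R]_n)
    (B : 'M[R]_(r, n)) (t : R) :
  B *m L = 0 -> B *m B^T = 1%:M ->
  \det (block_mx (- L - B^T *m B) ((A - t%:M) *m B^T) B 0) =
  (-1) ^+ (n + r) * \det (L + B^T *m B) * (char_poly (B *m A *m B^T)).[t].
Proof.
move=> BL BB.
have shear : \det (block_mx 1%:M 0 B 1%:M) = 1
  by rewrite det_lblock !det1 mulr1.
rewrite -[LHS]mul1r -[X in X * _]shear -det_mulmx mulmx_block.
rewrite !(mul1mx, mul0mx, mulmx1, mulmx0, add0r, addr0).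
rewrite mulmxBr mulmxN BL oppr0 sub0r mulmxA BB mul1mx addNr det_ublock.
rewrite horner_char_poly mulmxA mulmxBr mulmxBl mul_mx_scalar -scalemxAl BB.
rewrite scalemx1 -[B *m A *m B^T - _]opprB -opprD -!scaleN1r !detZ exprD.
by rewrite -!mulrA; congr (_ * _); rewrite mulrCA.
Qed.

(** Isolates the dependence on [e]: the bordered matrix is affine in [e], and for
    [Y = (A - t%:M) *m B^T] its constant term is the matrix of [det_bordered0]. *)
Lemma bordered_affine (R : comNzRingType) n r (L A : 'M[R]_n)
    (B : 'M[R]_(r, n)) (Y : 'M[R]_(n, r)) (e t : R) :
  block_mx ((e * t)%:M - (L + e *: A) - B^T *m B) Y B 0 =
  block_mx (- L - B^T *m B) Y B 0 + e *: block_mx (t%:M - A) 0 0 0.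
Proof.
rewrite scale_block_mx add_block_mx !scaler0 !addr0; congr (block_mx _ _ _ _).
rewrite scalerBr scale_scalar_mx opprD [RHS]addrC -!addrA.
by congr (_ + _); rewrite addrCA.
Qed.

(** * Connected components and edge counts *)

Lemma components_indexing (n r : nat) (G : rel 'I_n) (C : 'I_r -> {set 'I_n}) :
  symmetric G -> injective C -> [set C i | i : 'I_r]%SET = components G ->
  [/\ forall i, C i != finset.set0,
      forall i j, i != j -> [disjoint C i & C j],
      forall x, exists i, x \in C i
    & forall i x y, x \in C i -> (y \in C i) = connect G x y].
Proof.
move=> symG injC compC; have csym := sym_connect_sym symG.
have CiE i : exists x, C i = [set y | connect G x y]%SET.
  have : C i \in components G by rewrite -compC imset_f.
  by move=> /imsetP[x _ ->]; exists x; apply/setP => y; rewrite !inE.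
have connC i x y : x \in C i -> (y \in C i) = connect G x y.
  by have [z ->] := CiE i; rewrite !inE => zx; exact: same_connect csym _ _ zx _.
split=> // [i|i j ij|x].
- by have [x ->] := CiE i; apply/set0Pn; exists x; rewrite inE connect0.
- apply/pred0P => x; apply/negbTE/negP => /andP[/= xi xj].
  by case/eqP: ij; apply: injC; apply/setP => y; rewrite (connC _ x _ xi) (connC _ x _ xj).
- have : [set y in [set: 'I_n]%SET | connect G x y]%SET \in components G.
    by apply: imset_f; rewrite inE.
  by rewrite -compC => /imsetP[i _ E]; exists i; rewrite -E !inE connect0.
Qed.

Lemma eq_set2 (T : finType) (a b x y : T) : a != b ->
  ([set a; b] == [set x; y])%SET = ((a, b) == (x, y)) || ((a, b) == (y, x)).
Proof.
move=> ab; apply/eqP/orP => [S|[] /eqP[-> ->] //]; last by rewrite finset.setUC.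
have := set21 a b; have := set22 a b; rewrite S !inE.
move=> /orP[]/eqP bE /orP[]/eqP aE; subst; rewrite ?eqxx // in ab *; auto.
Qed.

(* Ordered pairs, whereas [edges_between] consists of unordered ones. *)
Definition dart_set (n : nat) (e : rel 'I_n) (A B : {set 'I_n}) :=
  [set p : 'I_n * 'I_n | [&& p.1 \in A, p.2 \in B & e p.1 p.2]]%SET.

Lemma card_dart_set (n : nat) (e : rel 'I_n) (A B : {set 'I_n}) :
  #|dart_set n e A B| = (\sum_(x in A) \sum_(y in B) e x y)%N.
Proof.
rewrite -sum1_card pair_big /= [RHS](eq_bigr (fun p => if e p.1 p.2 then 1 else 0)%N).
  by rewrite -big_mkcondr /=; apply: eq_bigl => p; rewrite inE andbA.
by move=> p _; case: (e _ _).
Qed.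

Lemma edges_between_imset (n : nat) (e : rel 'I_n) (A B : {set 'I_n}) :
  edges_between e A B = [set [set p.1; p.2] | p in dart_set n e A B]%SET.
Proof.
apply/setP => S; apply/imset2P/imsetP => [[x y xA]|[[x y]]].
  by rewrite inE => /andP[yB exy] ->; exists (x, y); rewrite // inE /= xA yB.
by rewrite inE /= => /and3P[xA yB exy] ->; exists x y; rewrite // inE yB.
Qed.

(** By symmetry and irreflexivity each edge inside [A] comes from exactly two darts, [(x, y)] and
    [(y, x)]. This is the factor 2 on the diagonal of [component_mx]. *)
Lemma sum_adjacency_within (n : nat) (e : rel 'I_n) (A : {set 'I_n}) :
  simple_graph e ->
  (\sum_(x in A) \sum_(y in A) e x y = 2 * #|edges_between e A A|)%N.
Proof.
move=> [sym irr]; rewrite -card_dart_set -sum1_card edges_between_imset.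
rewrite (partition_big_imset (fun p => [set p.1; p.2]%SET)) /= mulnC -sum_nat_const.
apply: eq_bigr => S /imsetP[[x y]]; rewrite inE /= => /and3P[xA yA exy] ->{S}.
have neq u v : e u v -> u != v by apply: contraTneq => ->; rewrite irr.
have <- : #|[set (x, y); (y, x)]%SET| = 2%N.
  by rewrite cards2 xpair_eqE negb_and neq.
rewrite sum1dep_card; apply: eq_card => -[u v]; rewrite !inE /=.
case euv: (e u v); first rewrite eq_set2 ?neq // !xpair_eqE.
  by apply/andP/idP => [[]//|/orP[]/andP[/eqP-> /eqP->]]; rewrite ?xA ?yA ?eqxx ?orbT.
rewrite !andbF; apply/esym/negP => /orP[]/eqP[ux vy]; move: euv.
  by rewrite ux vy exy.
by rewrite ux vy sym exy.
Qed.

(** Disjointness determines which endpoint comes first, so passing from darts to unordered pairs is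
    injective and nothing is counted twice. *)
Lemma sum_adjacency_between (n : nat) (e : rel 'I_n) (A B : {set 'I_n}) :
  [disjoint A & B] ->
  (\sum_(x in A) \sum_(y in B) e x y = #|edges_between e A B|)%N.
Proof.
move=> dAB; rewrite -card_dart_set edges_between_imset card_in_imset //.
have nAB x y : x \in A -> y \in B -> x != y.
  by move=> xA; apply: contraTneq => <-; rewrite (disjointFr dAB).
move=> [x y] [u v]; rewrite !inE /= => /and3P[xA yB _] /and3P[uA vB _] /eqP.
rewrite eq_set2 ?nAB // => /orP[/eqP//|/eqP[xv yu]].
by have := nAB _ _ xA vB; rewrite xv eqxx.
Qed.

(** * Normalised indicators of the components *)

Definition indicator_mx (R : realType) (n r : nat) (C : 'I_r -> {set 'I_n}) :
    'M[R]_(r, n) :=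
  \matrix_(i, x) ((x \in C i)%:R / Num.sqrt #|C i|%:R).

Lemma component_mxE (R : realType) (n r : nat) (H : rel 'I_n)
    (C : 'I_r -> {set 'I_n}) :
  simple_graph H -> (forall i j, i != j -> [disjoint C i & C j]) ->
  indicator_mx R n r C *m adjacency R H *m (indicator_mx R n r C)^T =
  component_mx R H C.
Proof.
move=> simpleH dC; apply/matrixP => i j; rewrite !mxE.
transitivity ((\sum_(x in C i) \sum_(y in C j) H x y)%:R
                / (Num.sqrt #|C i|%:R * Num.sqrt #|C j|%:R) : R).
  rewrite exchange_big /= natr_sum mulr_suml [RHS]big_mkcond /=.
  apply: eq_bigr => y _; rewrite !mxE; case: (y \in C j); last by rewrite mul0r mulr0.
  rewrite natr_sum !mulr_suml [RHS]big_mkcond /=; apply: eq_bigr => x _; rewrite !mxE.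
  by case: (x \in C i); rewrite ?mul0r // !mul1r invfM mulrAC mulrC mulrA.
case: eqP => [->|/eqP/dC/sum_adjacency_between->].
  by rewrite sum_adjacency_within // natrM -expr2 sqr_sqrtr.
by rewrite sqrtrM.
Qed.

Lemma indicator_mx_orthonormal (R : realType) (n r : nat)
    (C : 'I_r -> {set 'I_n}) :
  (forall i, C i != finset.set0) -> (forall i j, i != j -> [disjoint C i & C j]) ->
  indicator_mx R n r C *m (indicator_mx R n r C)^T = 1%:M.
Proof.
move=> nC dC; apply/matrixP => i j; rewrite !mxE; case: eqP => [<-|/eqP ij].
  transitivity (\sum_(x in C i) (#|C i|%:R^-1 : R)).
    rewrite [RHS]big_mkcond; apply: eq_bigr => x _; rewrite !mxE.
    by case: (x \in C i); rewrite ?mul0r // mul1r -invfM -expr2 sqr_sqrtr.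
  by rewrite sumr_const -[LHS]mulr_natl mulfV // pnatr_eq0 cards_eq0.
apply: big1 => x _; rewrite !mxE.
by case: (boolP (x \in C i)) => [xi|]; rewrite ?(disjointFr (dC _ _ ij) xi) !mul0r ?mulr0.
Qed.

(** * The Laplacian, its quadratic form and its kernel *)

Lemma laplacian_sym (R : realType) (n : nat) (e : rel 'I_n) :
  symmetric e -> (laplacian R e)^T = laplacian R e.
Proof.
move=> sym; rewrite /laplacian linearB /= tr_diag_mx; congr (_ - _).
by apply/matrixP => i j; rewrite !mxE sym.
Qed.

(** In this difference form the Laplacian visibly kills columns that are constant along edges, and
    its quadratic form becomes a sum of squares. *)
Lemma mul_laplacian_colE (R : realType) (n m : nat) (e : rel 'I_n)
    (u : 'M[R]_(n, m)) (x : 'I_n) (i : 'I_m) :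
  (laplacian R e *m u) x i = \sum_y (e x y)%:R * (u x i - u y i).
Proof.
rewrite mulmxBl mul_diag_mx !mxE [RHS](eq_bigr (fun y => (e x y)%:R * u x i - (e x y)%:R * u y i)).
  rewrite sumrB -mulr_suml -natr_sum; congr (_%:R * _ - _).
    by rewrite -sum1dep_card big_mkcond; apply: eq_bigr => y _; case: (e x y).
  by apply: eq_bigr => y _; rewrite mxE.
by move=> y _; rewrite mulrBr.
Qed.

Lemma laplacian_indicator (R : realType) (n r : nat) (e : rel 'I_n)
    (C : 'I_r -> {set 'I_n}) :
  (forall i x y, e x y -> (x \in C i) = (y \in C i)) ->
  laplacian R e *m (indicator_mx R n r C)^T = 0.
Proof.
move=> eC; apply/matrixP => x i; rewrite mul_laplacian_colE [RHS]mxE.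
apply: big1 => y _; rewrite !mxE; case: (boolP (e x y)) => [/eC->|_].
  by rewrite subrr mulr0.
by rewrite mul0r.
Qed.

(** The Dirichlet energy of [u]. The sum runs over ordered pairs and meets every edge twice, hence
    the [*+ 2]. *)
Lemma laplacian_form (R : realType) (n : nat) (e : rel 'I_n) (u : 'cV[R]_n) :
  symmetric e ->
  (u^T *m laplacian R e *m u) 0 0 *+ 2 =
  \sum_x \sum_y (e x y)%:R * (u x 0 - u y 0) ^+ 2.
Proof.
move=> sym; rewrite -mulmxA mxE.
have E : \sum_j u^T 0 j * (laplacian R e *m u) j 0 =
    \sum_x \sum_y u x 0 * ((e x y)%:R * (u x 0 - u y 0)).
  by apply: eq_bigr => x _; rewrite mul_laplacian_colE mulr_sumr; apply: eq_bigr => y _; rewrite mxE.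
(* One of the two copies is summed with [x] and [y] exchanged, so that the terms pair up as [u x *
   (u x - u y) + u y * (u y - u x) = (u x - u y) ^+ 2]. *)
rewrite mulr2n {2}E exchange_big E -big_split; apply: eq_bigr => x _.
rewrite -big_split; apply: eq_bigr => y _ /=.
by rewrite sym; case: (e y x); rewrite ?(mul0r, mulr0, addr0) // !mul1r expr2; ring.
Qed.

(** Both summands are positive semidefinite, so a null vector annihilates both quadratic forms. Zero
    energy makes it constant on each component, and orthogonality to the indicators makes each
    constant zero. *)
Lemma laplacian_indicator_unitmx (R : realType) (n r : nat) (e : rel 'I_n)
    (C : 'I_r -> {set 'I_n}) :
  symmetric e ->
  (forall x, exists i, x \in C i) ->
  (forall i x y, x \in C i -> (y \in C i) = connect e x y) ->
  laplacian R e + (indicator_mx R n r C)^T *m indicator_mx R n r C \in unitmx.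
Proof.
move=> sym covC connC; set B := indicator_mx R n r C.
rewrite -unitmx_tr -row_free_unit; apply: inj_row_free => v.
rewrite linearD /= trmx_mul trmxK laplacian_sym // => vN0.
pose u := v^T.
have form0 : (u^T *m laplacian R e *m u) 0 0 *+ 2 + ((B *m u)^T *m (B *m u)) 0 0 *+ 2 = 0.
  rewrite -mulrnDl -[RHS](mul0rn _ 2); congr (_ *+ 2).
  transitivity ((v *m (laplacian R e + B^T *m B) *m u) 0 0); last by rewrite vN0 mul0mx mxE.
  rewrite /u trmx_mul trmxK; move: (laplacian R e) => N.
  by rewrite [v *m (_ + _)]mulmxDr mulmxDl !mulmxA [RHS]mxE.
have quad_ge0 : 0 <= \sum_x \sum_y (e x y)%:R * (u x 0 - u y 0) ^+ 2.
  by apply: sumr_ge0 => x _; apply: sumr_ge0 => y _; rewrite mulr_ge0 ?sqr_ge0.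
have norm_eq : ((B *m u)^T *m (B *m u)) 0 0 = \sum_i (B *m u) i 0 ^+ 2.
  by rewrite mxE; apply: eq_bigr => i _; rewrite mxE.
have norm_ge0 : 0 <= \sum_i (B *m u) i 0 ^+ 2 by apply: sumr_ge0 => i _; exact: sqr_ge0.
move: form0; rewrite laplacian_form // norm_eq => /eqP.
rewrite paddr_eq0 ?mulrn_wge0 // mulrn_eq0 /= => /andP[/eqP Lu0 /eqP Bu0].
have edge_const x y : e x y -> u x 0 = u y 0.
  move=> exy.
  have inner_ge0 z : true -> 0 <= \sum_w (e z w)%:R * (u z 0 - u w 0) ^+ 2.
    by move=> _; apply: sumr_ge0 => w _; rewrite mulr_ge0 ?sqr_ge0.
  have rowx := @psumr_eq0P _ _ _ _ inner_ge0 Lu0 x isT.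
  have := @psumr_eq0P _ _ _ _ (fun w _ => mulr_ge0 (ler0n _ _) (sqr_ge0 _)) rowx y isT.
  by rewrite exy mul1r => /eqP; rewrite sqrf_eq0 subr_eq0 => /eqP.
have conn_const x y : connect e x y -> u x 0 = u y 0.
  move=> /connectP[p]; elim: p x => [x _ -> //|z p IH x /= /andP[xz zp] yE].
  by rewrite (edge_const _ _ xz); exact: IH.
apply: trmx_inj; apply/matrixP => x j; rewrite ord1 -/u trmx0 [RHS]mxE.
have [i xi] := covC x.
have Ci_gt0 : 0 < #|C i|%:R :> R.
  by rewrite ltr0n card_gt0; apply/set0Pn; exists x.
have := @psumr_eq0P _ _ _ _ (fun i _ => sqr_ge0 ((B *m u) i 0)) Bu0 i isT.
(* As [C i] is the component of [x], all its [#|C i|] terms equal the one at [x]. *)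
have -> : (B *m u) i 0 = #|C i|%:R * (u x 0 / Num.sqrt #|C i|%:R).
  rewrite mulr_natl -sumr_const big_mkcond mxE; apply: eq_bigr => y _.
  rewrite !mxE (connC _ _ _ xi); case: (boolP (connect e x y)) => [/conn_const uxy|_].
    by move: uxy; rewrite /u !mxE => ->; rewrite mul1r mulrC.
  by rewrite !mul0r.
move/eqP; rewrite sqrf_eq0 !mulf_eq0 invr_eq0 sqrtr_eq0 leNgt Ci_gt0 orbF.
by rewrite gt_eqF //= => /eqP.
Qed.

(** * Limits as [e] tends to [0+] *)

Local Open Scope classical_set_scope.
Local Open Scope ring_scope.

(** For [e > 0] the relation gives [h e = e ^+ (r - m) * g e], where the power tends to 0 and [g]
    has a finite limit. *)
Lemma cvg_order_lt0 (R : realType) (m r : nat) (g h : R -> R) (a b : R) :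
  (forall e, 0 < e -> e ^+ m * h e = e ^+ r * g e) ->
  h e @[e --> 0^'+] --> a -> g e @[e --> 0^'+] --> b ->
  (m < r)%N -> a = 0.
Proof.
move=> hg ha gb mr.
have H : (e ^+ (r - m) * g e) @[e --> 0^'+] --> (0 : R).
  (* Since [0 ^+ 0] is 1, this relies on [m < r]. *)
  have {2}-> : 0 = 0 ^+ (r - m) * b :> R.
    by rewrite expr0n subn_eq0 leqNgt mr mul0r.
  apply: cvgM => //; apply: cvg_at_right_filter.
  exact: (@exprn_continuous R (r - m) (0 : R)).
apply: (norm_cvg_unique ha); apply: cvg_trans H; apply: near_eq_cvg.
near=> e; have e0 : 0 < e by near: e; exact: nbhs_right_gt.
apply: (@mulfI _ (e ^+ m)); first by rewrite expf_neq0 ?gt_eqF.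
by rewrite hg // mulrA -exprD subnKC // ltnW.
Unshelve. all: by end_near. Qed.

Lemma cvg_order_eq (R : realType) (m : nat) (g h : R -> R) (a b : R) :
  (forall e, 0 < e -> e ^+ m * h e = e ^+ m * g e) ->
  h e @[e --> 0^'+] --> a -> g e @[e --> 0^'+] --> b -> a = b.
Proof.
move=> hg ha gb; apply: (norm_cvg_unique ha).
apply: cvg_trans gb; apply: near_eq_cvg.
near=> e; have e0 : 0 < e by near: e; exact: nbhs_right_gt.
by apply: (@mulfI _ (e ^+ m)); rewrite ?hg // expf_neq0 ?gt_eqF.
Unshelve. all: by end_near. Qed.

Lemma bigO_sqr_div_cvg (R : realType) (f : R -> R) :
  f =O_ (0^'+) (fun e : R => e ^+ 2) -> f e / e @[e --> 0^'+] --> (0 : R).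
Proof.
move=> /eqO_exP [k k0 fk].
have ke : k * e @[e --> 0^'+] --> (0 : R).
  rewrite -[X in _ --> X](mulr0 k); apply: cvgM; first exact: cvg_cst.
  exact: cvg_at_right_filter cvg_id.
apply/cvgr0Pnorm_lt => d d0.
near=> e.
have e0 : 0 < e by near: e; exact: nbhs_right_gt.
rewrite normrM normfV (gtr0_norm e0) ltr_pdivrMr //.
have : `|f e| <= k * `|e ^+ 2| by near: e.
move=> /le_lt_trans; apply; rewrite ger0_norm ?sqr_ge0 // expr2 mulrA ltr_pM2r //.
near: e.
exact: cvgr_lt ke _ d0.
Unshelve. all: by end_near. Qed.

(** Factor by factor: if [mu0 i = 0], then [mu i e / e] tends to [mu1 i], as the remainder divided
    by [e] vanishes in the limit; otherwise [e * t - mu i e] tends to [- mu0 i], which is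
    nonzero. *)
Lemma cvg_rescaled_eigenvalues (R : realType) (n : nat) (mu : 'I_n -> R -> R)
    (mu0 mu1 : 'I_n -> R) (t : R) :
  (forall i : 'I_n,
      (fun eps : R => mu i eps - (mu0 i + eps * mu1 i))
        =O_ (0^'+) (fun eps : R => eps ^+ 2)) ->
  \prod_(i < n) (if mu0 i == 0 then t - mu i e / e else e * t - mu i e)
    @[e --> 0^'+] -->
  \prod_(i < n) (if mu0 i == 0 then t - mu1 i else - mu0 i).
Proof.
move=> expand_mu.
apply: cvg_big => [|i _]; first exact: mul_continuous.
have id0 : e @[e --> 0^'+] --> (0 : R) by exact: cvg_at_right_filter cvg_id.
have rem0 := bigO_sqr_div_cvg _ _ (expand_mu i).
case: eqP => [mu00|_].
- have H : (t - ((mu i e - (mu0 i + e * mu1 i)) / e + mu1 i)) @[e --> 0^'+] --> t - (0 + mu1 i).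
    by apply: cvgB; [exact: cvg_cst|apply: cvgD => //; exact: cvg_cst].
  rewrite add0r in H; apply: cvg_trans H; apply: near_eq_cvg; near=> e.
  have e0 : e != 0 by rewrite gt_eqF //; near: e; exact: nbhs_right_gt.
  by rewrite mu00 add0r mulrBl [e * _]mulrC mulfK // subrK.
(* The remainder is written as its quotient by [e] times [e], so that [rem0] applies again. *)
- have H : (e * t - ((mu i e - (mu0 i + e * mu1 i)) / e * e + (mu0 i + e * mu1 i)))
      @[e --> 0^'+] --> 0 * t - (0 * 0 + (mu0 i + 0 * mu1 i)).
    apply: cvgB; first by apply: cvgM => //; exact: cvg_cst.
    apply: cvgD; first exact: cvgM.
    by apply: cvgD; [exact: cvg_cst|apply: cvgM => //; exact: cvg_cst].
  rewrite !mul0r !add0r addr0 in H.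
  apply: cvg_trans H; apply: near_eq_cvg; near=> e.
  have e0 : e != 0 by rewrite gt_eqF //; near: e; exact: nbhs_right_gt.
  by rewrite divfK // subrK.
Unshelve. all: by end_near. Qed.

Lemma prod_rescale (R : fieldType) (n : nat) (P : pred 'I_n) (m : 'I_n -> R) (e t : R) :
  e != 0 ->
  \prod_(i < n) (e * t - m i) =
  e ^+ #|P| * \prod_(i < n) (if P i then t - m i / e else e * t - m i).
Proof.
move=> e0; rewrite -[e ^+ _]prodr_const (big_mkcond P) /= -big_split /=.
apply: eq_bigr => i _; case: (P i); last by rewrite mul1r.
by rewrite mulrBr mulrCA mulfV // mulr1.
Qed.

(** The Leibniz formula is a finite sum of finite products of entries. *)
Lemma cvg_det (R : realType) (n : nat) (M : R -> 'M[R]_n) (N : 'M[R]_n)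
    (F : set_system R) (FF : Filter F) :
  (forall i j, M e i j @[e --> F] --> N i j) -> \det (M e) @[e --> F] --> \det N.
Proof.
move=> MN; rewrite /determinant.
apply: cvg_big => [|s _]; first exact: add_continuous.
apply: cvgM; first exact: cvg_cst.
by apply: cvg_big => [|i _]; [exact: mul_continuous|exact: MN].
Qed.

Lemma cvg_det_affine (R : realType) (n : nat) (M N : 'M[R]_n) :
  \det (M + e *: N) @[e --> 0^'+] --> \det M.
Proof.
apply: cvg_det => i j.
have -> : (fun e => (M + e *: N) i j) = (fun e => M i j + e * N i j).
  by apply/funext => e; rewrite !mxE.
rewrite -[X in _ --> X]addr0 -[X in _ + X](mul0r (N i j)).
apply: cvgD; first exact: cvg_cst.
by apply: cvgM; [exact: cvg_at_right_filter cvg_id|exact: cvg_cst].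
Qed.

(** * Comparison of the two factorisations of the characteristic polynomial *)

Theorem corollary1 (R : realType) (n r : nat) (F G H : rel 'I_n)
    (C : 'I_r -> {set 'I_n})
    (mu : 'I_n -> R -> R) (mu0 mu1 : 'I_n -> R)
    (simpleF : simple_graph F)
    (simpleG : simple_graph G)
    (simpleH : simple_graph H)
    (disjGH : forall x y, ~~ (G x y && H x y))
    (unionGH : forall x y, F x y = G x y || H x y)
    (injC : injective C)
    (compC : [set C i | i : 'I_r]%SET = components G)
    (eig_mu : forall eps : R, 0 < eps ->
      eigenvalue_list (perturbed_laplacian G H eps)
        [seq mu i eps | i <- enum 'I_n])
    (expand_mu : forall i : 'I_n,
      (fun eps : R => mu i eps - (mu0 i + eps * mu1 i))
        =O_ (0^'+) (fun eps : R => eps ^+ 2)) :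
  exists theta : r.-tuple R,
    eigenvalue_list (component_mx R H C) theta /\
    perm_eq [seq mu1 i | i <- enum 'I_n & mu0 i == 0] theta.
Proof.
have [symG _] := simpleG.
have [nC dC covC connC] := components_indexing _ _ _ _ symG injC compC.
have eC i x y : G x y -> (x \in C i) = (y \in C i).
  move=> /connect1 xy; apply/idP/idP => [xi|yi]; first by rewrite (connC _ _ _ xi).
  by rewrite (connC _ _ _ yi) (sym_connect_sym symG).
pose B := indicator_mx R n r C; pose L := laplacian R G; pose A := adjacency R H.
have BB : B *m B^T = 1%:M := indicator_mx_orthonormal R n r C nC dC.
have LB : L *m B^T = 0 := laplacian_indicator R n r G C eC.
have BL : B *m L = 0.
  by apply: trmx_inj; rewrite trmx_mul laplacian_sym // LB trmx0.
pose k := (-1) ^+ (n + r) * \det (L + B^T *m B).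
have k0 : k != 0.
  rewrite mulf_neq0 ?signr_eq0 // -unitfE -[_ \in _]/(_ \in unitmx).
  exact: laplacian_indicator_unitmx.
pose k' := \prod_(i < n | mu0 i != 0) - mu0 i.
have k'0 : k' != 0 by apply/prodf_neq0 => i; rewrite oppr_eq0.
pose p := char_poly (component_mx R H C).
pose q := \prod_(i < n | mu0 i == 0) ('X - (mu1 i)%:P).
have monp : p \is monic by exact: char_poly_monic.
have monq : q \is monic by apply: monic_prod => i _; exact: monicXsubC.
pose P : pred 'I_n := [pred i | mu0 i == 0].
pose h t e := \prod_(i < n) (if P i then t - mu i e / e else e * t - mu i e).
pose g t e := \det (block_mx (- L - B^T *m B) ((A - t%:M) *m B^T) B 0
                     + e *: block_mx (t%:M - A) 0 0 0).
have h_cvg t : h t e @[e --> 0^'+] --> (k' *: q).[t].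
  have -> : (k' *: q).[t] = \prod_(i < n) (if P i then t - mu1 i else - mu0 i).
    rewrite hornerZ horner_prod /k' mulrC big_mkcond [X in _ * X]big_mkcond -big_split.
    apply: eq_bigr => i _ /=; rewrite /P hornerXsubC /=.
    by case: eqP; rewrite ?mulr1 ?mul1r.
  exact: cvg_rescaled_eigenvalues.
have g_cvg t : g t e @[e --> 0^'+] --> (k *: p).[t].
  rewrite hornerZ /k /p -(component_mxE _ _ _ _ _ simpleH dC) -det_bordered0 //.
  exact: cvg_det_affine.
(* Both sides are the characteristic polynomial of [perturbed_laplacian G H e] at [e * t]: on the
   left through its roots, on the right through the bordered determinant. *)
have hg t e : 0 < e -> e ^+ #|P| * h t e = e ^+ r * g t e.
  move=> e0; rewrite -prod_rescale ?gt_eqF // /g -bordered_affine.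
  rewrite -det_bordered_scale // -horner_char_poly.
  rewrite -[L + _]/(perturbed_laplacian G H e) (eig_mu _ e0) horner_prod.
  by rewrite big_map big_enum; apply: eq_bigr => i _; rewrite hornerXsubC.
(* If the orders differed, the side with the smaller power of [e] would have limit 0 for every [t],
   yet each limit is a nonzero multiple of a monic polynomial. *)
have mr : #|P| = r.
  case: (ltngtP #|P| r) => // mr.
  - have : k' *: q = 0.
      apply: poly_ext => t; rewrite horner0.
      exact: cvg_order_lt0 (hg t) (h_cvg t) (g_cvg t) mr.
    by move/eqP; rewrite scaler_eq0 (negbTE k'0) (negbTE (monic_neq0 monq)).
  - have : k *: p = 0.
      apply: poly_ext => t; rewrite horner0.
      exact: cvg_order_lt0 (fun e e0 => esym (hg t e e0)) (g_cvg t) (h_cvg t) mr.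
    by move/eqP; rewrite scaler_eq0 (negbTE k0) (negbTE (monic_neq0 monp)).
have kpq : k' *: q = k *: p.
  apply: poly_ext => t.
  apply: (@cvg_order_eq R r _ _ _ _ _ (h_cvg t) (g_cvg t)) => e e0.
  by rewrite -hg // mr.
have kk : k' = k.
  have := congr1 lead_coef kpq.
  by rewrite !lead_coefZ (monicP monp) (monicP monq) !mulr1.
have pq : q = p by apply: (scalerI k0); rewrite -kpq kk.
have sz : size [seq mu1 i | i <- enum 'I_n & mu0 i == 0] == r.
  by rewrite size_map -mr cardE enumT.
(* The list of the [mu1 i] itself serves as [theta]: the permutation is trivial, and the eigenvalue
   claim is [q = p]. *)
exists (Tuple sz); split => //=.
by rewrite /eigenvalue_list -/p -pq big_map big_filter big_enum_cond.
Qed.
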